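(* The Bessel polynomials $$y_n(x)=\sum_{k=0}^{n}\frac{(n+k)!}{(n-k)!\,k!}\left(\frac{x}{2}\right)^k,\qquad n\ge 0,$$ form a strongly $q$-log-convex sequence (in the variable $x$); that is, for all integers $n\ge m\ge 1$, the polynomial $y_{m-1}(x)y_{n+1}(x)-y_m(x)y_n(x)$ has only nonnegative coefficients.
   Context: For real polynomials in one variable $q$, $f(q)\ge_q g(q)$ means that $f(q)-g(q)$ has only nonnegative coefficients. A sequence of real polynomials $\{f_n(q)\}_{n\ge 0}$ is strongly $q$-log-convex if $f_{m-1}(q)f_{n+1}(q)\ge_q f_m(q)f_n(q)$ for all $n\ge m\ge 1$. *)

(* Defs.v *)
From mathcomp Require Import all_boot all_order all_algebra.
Set Implicit Arguments.
Unset Strict Implicit.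
Unset Printing Implicit Defensive.
Import Order.TTheory GRing.Theory Num.Theory.
Local Open Scope ring_scope.

(* f >=_q g *)
Definition qge (R : realFieldType) (f g : {poly R}) : Prop :=
  f - g \is a polyOver Num.nneg.

Definition strongly_q_log_convex (R : realFieldType) (f : nat -> {poly R}) :
    Prop :=
  forall m n : nat, (1 <= m)%N -> (m <= n)%N ->
    qge (f m.-1 * f n.+1) (f m * f n).

Definition bessel_poly (R : realFieldType) (n : nat) : {poly R} :=
  \sum_(0 <= k < n.+1)
    ((n + k)`!%:R / ((n - k)`!%:R * k`!%:R)) *: (2%:R^-1 *: 'X) ^+ k.

(* Main.v *)
(** Extend the sequence by [y_(-1) = 1], so that
    [y_(n+1) = (2n+1) x y_n + y_(n-1)] holds for all [n >= 0].  Write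
    [D(m, n) = y_(m-1) y_(n+1) - y_m y_n].  Applying the recurrence to
    [y_(n+1)] and [y_m] gives
    [D(m, n) = 2(n-m+1) x y_(m-1) y_n - D(m-1, n-1)], whose sign is wrong for
    an induction; applying it twice gives
    [D(m, n) = 2(n-m+1) x (y_(m-1) y_n - y_(m-2) y_(n-1)) + D(m-2, n-2)],
    where the bracket is nonnegative because the coefficients of [y_n]
    increase with [n]. *)
Require Import Defs.
From mathcomp Require Import all_boot all_order all_algebra.
From mathcomp Require Import ring zify.
Set Implicit Arguments.
Unset Strict Implicit.
Unset Printing Implicit Defensive.
Import Order.TTheory GRing.Theory Num.Theory.
Local Open Scope ring_scope.

Section Bessel.

Variable R : realFieldType.
Implicit Types (f g : {poly R}) (m n k : nat).

Local Notation nonneg_poly := (polyOver (@Num.nneg R)).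

Lemma nneg_polyP f : reflect (forall k, 0 <= f`_k) (f \is a nonneg_poly).
Proof. by apply: (iffP polyOverP) => f_ge0 k; have := f_ge0 k. Qed.

Lemma nneg_polyD f g :
  f \is a nonneg_poly -> g \is a nonneg_poly -> f + g \is a nonneg_poly.
Proof.
move=> /nneg_polyP f_ge0 /nneg_polyP g_ge0.
by apply/nneg_polyP => k; rewrite coefD addr_ge0.
Qed.

Lemma nneg_polyM f g :
  f \is a nonneg_poly -> g \is a nonneg_poly -> f * g \is a nonneg_poly.
Proof.
move=> /nneg_polyP f_ge0 /nneg_polyP g_ge0.
by apply/nneg_polyP => k; rewrite coefM sumr_ge0 // => i _; rewrite mulr_ge0.
Qed.

Lemma nneg_polyXM f : f \is a nonneg_poly -> 'X * f \is a nonneg_poly.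
Proof.
move=> /nneg_polyP f_ge0; apply/nneg_polyP => k.
by rewrite coefXM; case: eqP.
Qed.

Lemma nneg_poly_scale_nat k f :
  f \is a nonneg_poly -> k%:R *: f \is a nonneg_poly.
Proof.
by move=> /nneg_polyP f_ge0; apply/nneg_polyP => i; rewrite coefZ mulr_ge0.
Qed.

(** The double factorial 1·3·5···(2k-1), written as a quotient of factorials. *)
Definition bessel_weight k : R := (2 * k)`!%:R / (k`!%:R * 2 ^+ k).

Lemma bessel_weight_ge0 k : 0 <= bessel_weight k.
Proof. by rewrite divr_ge0 ?mulr_ge0 ?exprn_ge0 ?ler0n. Qed.

Lemma bessel_weightS k :
  bessel_weight k.+1 = (2 * k).+1%:R * bessel_weight k.
Proof.
rewrite /bessel_weight mulnS !factS exprS.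
have k_neq0 : k`!%:R != 0 :> R by rewrite pnatr_eq0 -lt0n fact_gt0.
have e_neq0 : 2 ^+ k != 0 :> R by rewrite expf_neq0 // pnatr_eq0.
have -> : (2 * k).+2 = (2 * k.+1)%N by rewrite mulnS.
rewrite !natrM.
have kS_neq0 : k.+1%:R != 0 :> R by rewrite pnatr_eq0.
by field; rewrite nat1r kS_neq0 k_neq0 e_neq0.
Qed.

(** Multiplying and dividing by (2k)! isolates the dependence on [n] in a single binomial, which
    vanishes for [k > n]. *)
Lemma coef_bessel n k :
  (bessel_poly R n)`_k = 'C(n + k, 2 * k)%:R * bessel_weight k.
Proof.
rewrite /bessel_poly coef_sum big_mkord.
under eq_bigr => i _ do rewrite coefZ exprZn coefZ coefXn exprVn.
have [lekn|ltnk] := leqP k n.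
  rewrite (bigD1 (Ordinal (lekn : k < n.+1)%N)) //= eqxx big1 ?addr0; last first.
    by move=> i; rewrite -val_eqE /= eq_sym => /negPf->; rewrite !mulr0.
  have Hb := @bin_fact (n + k) (2 * k) ltac:(lia).
  rewrite (_ : n + k - 2 * k = n - k)%N in Hb; last by lia.
  rewrite -Hb !natrM /bessel_weight.
  have nz j : j`!%:R != 0 :> R by rewrite pnatr_eq0 -lt0n fact_gt0.
  have e_neq0 : 2 ^+ k != 0 :> R by rewrite expf_neq0 // pnatr_eq0.
  by rewrite mulr1; field; rewrite !nz e_neq0.
rewrite bin_small ?mul0r; last by lia.
rewrite big1 // => i _; rewrite (_ : (k == i) = false) ?mulr0 //.
by have := ltn_ord i; lia.
Qed.

(* [bessel_ext n] is y_(n-1), with y_(-1) = 1. *)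
Definition bessel_ext n : {poly R} :=
  if n is n'.+1 then bessel_poly R n' else 1.

(** At [n = 0] the truncated predecessor gives C(0, 0) = 1 for [k = 0] and C(k-1, 2k) = 0 for
    [k > 0], as the constant 1 requires. *)
Lemma coef_bessel_ext n k :
  (bessel_ext n)`_k = 'C((n + k).-1, 2 * k)%:R * bessel_weight k.
Proof.
case: n => [|n]; last exact: coef_bessel.
case: k => [|k].
  by rewrite coef1 /bessel_weight muln0 bin0 fact0 expr0 mulr1 divr1 mulr1.
by rewrite coef1 /= bin_small ?mul0r //; lia.
Qed.

Lemma bessel_ext_rec n :
  bessel_ext n.+2 = (2 * n).+1%:R *: ('X * bessel_ext n.+1) + bessel_ext n.
Proof.
apply/polyP => -[|k]; rewrite coefD coefZ coefXM !coef_bessel_ext /=.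
  by rewrite mulr0 add0r !bin0.
rewrite bessel_weightS (_ : n.+1 + k.+1 = (n + k).+2)%N; last by lia.
rewrite (_ : (n + k.+1).-1 = n + k)%N; last by lia.
move: (bessel_weight k) => w.
rewrite mulnS !mulrA -mulrDl -!natrM -natrD; congr (_%:R * _).
(* With N = n + k, Pascal's rule applied twice leaves (j+1)(2 C(N, j+1) + C(N, j)) = (2n+1) C(N, j),
   which follows from (j+1) C(N, j+1) = (N-j) C(N, j). *)
set j := (2 * k)%N; rewrite (_ : 2 + j = j.+2)%N // !binS.
have := mul_bin_left (n + k) j.
have [lekn|ltnk] := leqP k n.
  rewrite (_ : n + k - j = n - k)%N; last by lia.
  nia.
by rewrite (@bin_small _ j) ?(@bin_small _ j.+1); lia.
Qed.

Lemma bessel_ext1 : bessel_ext 1 = 1.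
Proof. by rewrite /= /bessel_poly big_nat1 !fact0 mulr1 divr1 scale1r expr0. Qed.

Lemma bessel_ext_nneg n : bessel_ext n \is a nonneg_poly.
Proof.
apply/nneg_polyP => k.
by rewrite coef_bessel_ext mulr_ge0 ?bessel_weight_ge0.
Qed.

Lemma bessel_ext_incr n : bessel_ext n.+1 - bessel_ext n \is a nonneg_poly.
Proof.
apply/nneg_polyP => k; rewrite coefB !coef_bessel_ext -mulrBl.
by rewrite mulr_ge0 ?bessel_weight_ge0 // subr_ge0 ler_nat leq_bin2l; lia.
Qed.

Lemma bessel_ext_mul_incr m n :
  bessel_ext m.+1 * bessel_ext n.+1 - bessel_ext m * bessel_ext n
    \is a nonneg_poly.
Proof.
set a := bessel_ext m.+1; set b := bessel_ext n.+1.
rewrite (_ : _ - _ = a * (b - bessel_ext n)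
                     + (a - bessel_ext m) * bessel_ext n); last by ring.
by rewrite nneg_polyD ?nneg_polyM ?bessel_ext_nneg ?bessel_ext_incr.
Qed.

(** This is D(m, n) itself: the shift in [bessel_ext] lets [m] start at 0. *)
Definition bessel_det m n : {poly R} :=
  bessel_ext m * bessel_ext n.+2 - bessel_ext m.+1 * bessel_ext n.+1.

Lemma bessel_detSS m n : (m <= n)%N ->
  bessel_det m.+1 n.+1 =
  (2 * (n.+1 - m))%:R *: ('X * (bessel_ext m.+1 * bessel_ext n.+2))
    - bessel_det m n.
Proof.
move=> lemn; rewrite /bessel_det (bessel_ext_rec n.+1) (bessel_ext_rec m).
rewrite -!mul_polyC !polyC_natr.
(* Since [m <= n], this splitting removes the truncated subtraction and exposes the cancellation of
   the (2m+1) terms. *)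
have -> : (2 * n.+1).+1 = ((2 * (n.+1 - m)) + (2 * m).+1)%N by lia.
by rewrite natrD; ring.
Qed.

Lemma bessel_det0_nneg n : bessel_det 0 n \is a nonneg_poly.
Proof. by rewrite /bessel_det bessel_ext1 !mul1r bessel_ext_incr. Qed.

(** One descent step gives 2(n+1) x y_(n+1) - (y_(n+1) - y_n); expanding the subtracted y_(n+1) by
    the recurrence leaves x y_(n+1) + (2n+1) x (y_(n+1) - y_n) + (y_n - y_(n-1)). *)
Lemma bessel_det1_nneg n : bessel_det 1 n.+1 \is a nonneg_poly.
Proof.
rewrite bessel_detSS // subn0 /bessel_det.
rewrite bessel_ext1 !mul1r {2}bessel_ext_rec.
set a := bessel_ext n.+2; set b := bessel_ext n.+1; set c := bessel_ext n.
rewrite (_ : _ - _ = 'X * a + (2 * n).+1%:R *: ('X * (a - b)) + (b - c)).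
  apply: nneg_polyD; last exact: bessel_ext_incr.
  by rewrite nneg_polyD ?nneg_poly_scale_nat ?nneg_polyXM ?bessel_ext_nneg
             ?bessel_ext_incr.
rewrite -!mul_polyC !polyC_natr (_ : 2 * n.+1 = (2 * n).+1 + 1)%N; last by lia.
by rewrite natrD; ring.
Qed.

(** Induction on [m] in steps of two, hence the two base cases 0 and 1; at [m = n.+1] both products
    coincide. *)
Lemma bessel_det_nneg m n : (m <= n.+1)%N -> bessel_det m n \is a nonneg_poly.
Proof.
elim/ltn_ind: m n => m IH n; rewrite leq_eqVlt ltnS => /predU1P[->|lemn].
  by rewrite /bessel_det mulrC subrr polyOver0.
case: m n IH lemn => [|[|m]] n IH; first by rewrite bessel_det0_nneg.
  by case: n => // n _; rewrite bessel_det1_nneg.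
case: n => [|[|n]] //; rewrite !ltnS => lemn.
(* Both descents carry the same scalar, as [n - m] is unchanged, so their main terms combine into
   one difference. *)
rewrite !bessel_detSS // subSS opprB addrCA -scalerBr -mulrBr.
rewrite nneg_polyD ?nneg_poly_scale_nat ?nneg_polyXM ?bessel_ext_mul_incr // IH //.
exact: leqW.
Qed.

End Bessel.

Theorem corollary3p2 (R : realFieldType) :
  strongly_q_log_convex (@bessel_poly R).
Proof.
case=> [//|m] n _ lemn.
exact: (@bessel_det_nneg R m.+1 n (leqW lemn)).
Qed.
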